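(* Let $G$ be a connected graph of order $n$ with $m\ge1$ edges, and let $\lambda_m$ be its least $\mathcal{H}$-eigenvalue. Then (i) $\lambda_m\le\min\{\triangle(e)+2 : e\in E(G)\}$, with equality if and only if $G\cong K_n$; (ii) if $G\not\cong K_n$, then $\lambda_m\le\min\big\{\frac{\triangle(e_i)+\triangle(e_j)}{2}+1\big\}$, where the minimum is over all pairs of edges $e_i,e_j$ that form an induced path $P_3$ in $G$.
   Context: $\triangle(e)$ is the number of triangles of $G$ containing the edge $e$. Graphs are finite, simple and undirected. Fix an orientation of every edge (tail $e^-$, head $e^+$) and a cyclic orientation of every triangle. Let $\mathcal{B}$ be the $|E|\times|V|$ matrix with $b_{ev}=-1$ if $v=e^-$, $1$ if $v=e^+$, $0$ otherwise, and $\mathcal{C}$ the $|T|\times|E|$ matrix ($T$ the set of triangles) with $c_{\vartriangle e}=\pm1$ if $e$ is an edge of $\vartriangle$ (sign $+$ iff the orientation of $e$ agrees with that of $\vartriangle$) and $0$ otherwise. The Helmholtzian matrix is $\mathcal{H}(G)=\mathcal{B}\mathcal{B}^{\intercal}+\mathcal{C}^{\intercal}\mathcal{C}$; its eigenvalues ($\mathcal{H}$-eigenvalues) do not depend on the chosen orientations. *)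

(* Defs.v *)
From HB Require Import structures.
From mathcomp Require Import all_boot all_order all_algebra.
Set Implicit Arguments.
Unset Strict Implicit.
Unset Printing Implicit Defensive.
Import Order.TTheory GRing.Theory Num.Theory.
Local Open Scope ring_scope.

Section Graph.

Variable V : finType.
Implicit Types (e : rel V) (A t : {set V}).

Definition edges e : {set {set V}} :=
  [set A : {set V} | [exists x, exists y, e x y && (A == [set x; y])]].

Definition triangles e : {set {set V}} :=
  [set t : {set V} | (#|t| == 3)
     && [forall x in t, forall y in t, (x != y) ==> e x y]].

Definition triangle_count e A : nat := #|[set t in triangles e | A \subset t]|.

Definition edge_orientation e (tl hd : {set V} -> V) : Prop :=
  {in edges e, forall A, A = [set tl A; hd A]}.

(* [:: x; y; z] stands for the cyclic orientation x -> y -> z -> x; its three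
   rotations stand for the same orientation. *)
Definition triangle_orientation e (cyc : {set V} -> seq V) : Prop :=
  {in triangles e, forall t, perm_eq (cyc t) (enum t)}.

Definition induced_P3 e A1 A2 : Prop :=
  exists x y z, [/\ A1 = [set x; y], A2 = [set y; z],
                    x != z, e x y && e y z & ~~ e x z].

Variable R : pzRingType.

Definition incidence e (tl hd : {set V} -> V) : 'M[R]_(#|edges e|, #|V|) :=
  \matrix_(i < #|edges e|, j < #|V|)
    let A := enum_val i in let v := enum_val j in
    if v == tl A then -1 else if v == hd A then 1 else 0.

Definition triangle_incidence e (tl hd : {set V} -> V)
    (cyc : {set V} -> seq V) : 'M[R]_(#|triangles e|, #|edges e|) :=
  \matrix_(i < #|triangles e|, j < #|edges e|)
    let t := enum_val i in let A := enum_val j in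
    if A \subset t then
      if next (cyc t) (tl A) == hd A then 1 else -1
    else 0.

Definition helmholtzian e (tl hd : {set V} -> V) (cyc : {set V} -> seq V) :
    'M[R]_#|edges e| :=
  let B := incidence e tl hd in
  let C := triangle_incidence e tl hd cyc in
  B *m B^T + C^T *m C.

End Graph.

Arguments incidence {V} R e tl hd.
Arguments triangle_incidence {V} R e tl hd cyc.
Arguments helmholtzian {V} R e tl hd cyc.

Definition graph_iso (V W : finType) (e : rel V) (f : rel W) : Prop :=
  exists2 h : V -> W, bijective h & forall x y, f (h x) (h y) = e x y.

Definition complete_graph (n : nat) : rel 'I_n := fun i j => i != j.

Definition is_least (R : numDomainType) (P : R -> Prop) (x : R) : Prop :=
  P x /\ forall y, P y -> x <= y.

(* Main.v *)
(* The bounds are Rayleigh quotients of H on vectors supported on at most two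
   edges.  The diagonal entries of H are triangle(e) + 2; two edges xy, yz have
   entry +-1 if xz is not an edge, and 0 otherwise, because the contribution of
   the triangle xyz cancels that of y.  So H = n I for K_n.

   If equality holds in (i), let xy be an edge with triangle(xy) + 2 = lam.
   Then H - lam is positive semidefinite with a zero diagonal entry at xy, so
   its row xy vanishes and xy lies in no induced P_3: N(x) - y and N(y) - x
   coincide.  Hence triangle(xy) = deg x - 1 >= triangle(xz) for every
   neighbour z of x, so all edges at x are minimal too.  By connectedness every
   edge is minimal, there is no induced P_3, and G is complete. *)

Require Import Defs.
From HB Require Import structures.
From mathcomp Require Import all_boot all_order all_algebra.
From mathcomp Require Import sesquilinear spectral complex ring lra.
Set Implicit Arguments.
Unset Strict Implicit.
Unset Printing Implicit Defensive.
Import Order.TTheory GRing.Theory Num.Theory.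
Local Open Scope ring_scope.

(** * Rayleigh bounds for a real symmetric matrix *)

Lemma rayleigh_le (R : rcfType) n (A : 'M[R]_n) (lam : R) (v : 'rV_n) :
    A^T = A -> (forall x, eigenvalue A x -> lam <= x) ->
  lam * (v *m v^T) 0 0 <= (v *m A *m v^T) 0 0.
Proof.
move=> A_sym lam_le.
(* [A] is diagonalised as a Hermitian matrix over the complex extension of [R]. *)
pose toC := real_complex R; pose AC := map_mx toC A; pose w := map_mx toC v.
have AC_real : AC \is a mxOver Num.real.
  by apply/mxOverP => i j; rewrite mxE; apply/complex_realP; exists (A i j).
have AC_sym : AC \is symmetricmx.
  apply/is_hermitianmxP; rewrite expr0 scale1r map_mx_id //.
  by apply/matrixP => i j; rewrite !mxE -[in LHS]A_sym mxE.
have AC_herm := realsym_hermsym AC_sym AC_real.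
pose P := spectralmx AC; pose d := spectral_diag AC.
have P_unit : P \is unitarymx by apply: spectral_unitarymx.
have ACE : AC = invmx P *m diag_mx d *m P.
  exact/orthomx_spectralP/hermitian_normalmx.
(* A diagonal entry of [d] is real and is a root of the characteristic polynomial of [AC], the image
   of that of [A]; so it comes from an eigenvalue of [A]. *)
have d_ge i : toC lam <= d 0 i.
  have /mxOverP/(_ 0 i)/complex_realP[x dx] :=
    hermitian_spectral_diag_real AC_herm.
  rewrite -/d in dx; rewrite dx lecR; apply: lam_le.
  rewrite eigenvalue_root_char -(fmorph_root toC) map_char_poly.
  rewrite -eigenvalue_root_char.
  apply/eigenvalueP; exists (row i P).
    rewrite -/AC ACE -row_mul !mulmxA mulmxV ?unitarymx_unit // mul1mx.
    by rewrite row_mul row_diag_mx -scalemxAl -rowE dx.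
  apply/eqP => Pi0; have := row_mul i P (invmx P).
  rewrite Pi0 mul0mx mulmxV ?unitarymx_unit // => /rowP/(_ i).
  by rewrite !mxE eqxx => /eqP; rewrite oner_eq0.
(* Since w is real, u^* is P w^T, and both forms are diagonal in u. *)
pose u := w *m (map_mx Num.conj P)^T.
have wT : w^T = map_mx Num.conj w^T.
  apply/matrixP => i j; rewrite !mxE; apply/esym/CrealP/complex_realP.
  by exists (v j i).
have PE : invmx P = (map_mx Num.conj P)^T by rewrite invmx_unitary // map_trmx.
have uT : P *m w^T = map_mx Num.conj u^T.
  rewrite /u trmx_mul trmxK map_mxM -wT; congr (_ *m _).
  apply/matrixP => i j; rewrite !mxE; exact/esym/conjCK.
have uE (i : 'I_n) : (P *m w^T) i 0 = (u 0 i)^* by rewrite uT !mxE.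
have -> : (lam * (v *m v^T) 0 0 <= (v *m A *m v^T) 0 0) =
    (toC lam * (w *m w^T) 0 0 <= (w *m AC *m w^T) 0 0).
  rewrite -lecR (rmorphM toC) /w /AC !map_trmx -!map_mxM.
  by rewrite ![map_mx _ _ _ _]mxE.
have -> : w *m w^T = u *m (P *m w^T).
  by rewrite /u -PE !mulmxA mulmxKV ?unitarymx_unit.
have -> : w *m AC *m w^T = u *m diag_mx d *m (P *m w^T).
  by rewrite ACE PE /u !mulmxA.
rewrite mxE [leRHS]mxE mulr_sumr; apply: ler_sum => i _.
rewrite uE mul_mx_diag mxE [_ * d 0 i]mulrC -mulrA ler_wpM2r //.
exact: mul_conjC_ge0.
Qed.

Lemma rayleigh_diag (R : rcfType) n (A : 'M[R]_n) (lam : R) (i : 'I_n) :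
    A^T = A -> (forall x, eigenvalue A x -> lam <= x) -> lam <= A i i.
Proof.
move=> A_sym lam_le; have := rayleigh_le (delta_mx 0 i) A_sym lam_le.
by rewrite trmx_delta mul_delta_mx -rowE -colE !mxE eqxx mulr1.
Qed.

(** Both weights stay free: part (ii) takes signs, the equality case a weight adapted to the
    entries. *)
Lemma rayleigh_pair (R : rcfType) n (A : 'M[R]_n) (lam a b : R) (i j : 'I_n) :
    A^T = A -> (forall x, eigenvalue A x -> lam <= x) -> i != j ->
  lam * (a ^+ 2 + b ^+ 2) <=
    a ^+ 2 * A i i + a * b * A i j *+ 2 + b ^+ 2 * A j j.
Proof.
move=> A_sym lam_le ij.
have := rayleigh_le (a *: delta_mx 0 i + b *: delta_mx 0 j) A_sym lam_le.
have Aji : A j i = A i j by rewrite -[in LHS]A_sym mxE.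
rewrite linearD !linearZ /= !trmx_delta !mulmxDl !mulmxDr.
rewrite -!scalemxAl -!scalemxAr.
rewrite !mul_delta_mx_cond -!rowE -!colE !mxE !eqxx Aji (negPf ij).
rewrite [j == i]eq_sym (negPf ij).
rewrite !mulr1n !mulr0n !mxE !eqxx /=.
by congr (_ <= _); [congr (_ * _)|]; ring.
Qed.


(** Three points have only two cyclic orders, and the truth of [next s x == y] tells which one [s]
    is. *)
Lemma next_cycle3 (T : eqType) (s : seq T) (x y z : T) :
    uniq s -> size s = 3 -> x \in s -> y \in s -> z \in s ->
    uniq [:: x; y; z] ->
  [/\ (next s y == x) = (next s x != y), (next s y == z) = (next s x == y)
    & (next s z == y) = (next s x != y)].
Proof.
case: s => [|a [|b [|c []]]] //= /and3P[]; rewrite !inE negb_or !andbT.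
move=> /andP[ab ac] bc _ _ xs ys zs; rewrite negb_or => /andP[/andP[xy xz] yz].
have ba : b == a = false by rewrite eq_sym (negPf ab).
have ca : c == a = false by rewrite eq_sym (negPf ac).
have cb : c == b = false by rewrite eq_sym (negPf bc).
move: ab ac bc xy xz yz.
by case/or3P: xs => /eqP->; case/or3P: ys => /eqP->; case/or3P: zs => /eqP->;
  rewrite ?eqxx //= => ab ac bc _ _ _;
  do ?rewrite ?eqxx ?ba ?ca ?cb ?(negPf ab) ?(negPf ac) ?(negPf bc) /=.
Qed.

Lemma ex_min_fin (T : finType) (R : realDomainType) (P : pred T) (F : T -> R) :
    (exists i, P i) -> exists2 i, P i & forall j, P j -> F i <= F j.
Proof.
by case=> i0 Pi0; case: (arg_minP F Pi0) => i Pi leF; exists i.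
Qed.

(** * Edges, triangles and common neighbours *)

Section Graph.

Variables (V : finType) (e : rel V).
Hypotheses (e_sym : symmetric e) (e_irr : irreflexive e).
Implicit Types (x y z v : V) (A t : {set V}).

Lemma edge_neq x y : e x y -> x != y.
Proof. by apply: contraTneq => ->; rewrite e_irr. Qed.

Lemma edgesP A : reflect (exists x y, e x y /\ A = [set x; y]) (A \in edges e).
Proof.
rewrite inE; apply: (iffP existsP) => [[x /existsP[y /andP[xy /eqP->]]]|].
  by exists x, y.
by case=> x [y [xy ->]]; exists x; apply/existsP; exists y; rewrite xy eqxx.
Qed.

Lemma mem_edges x y : e x y -> [set x; y] \in edges e.
Proof. by move=> xy; apply/edgesP; exists x, y. Qed.

Lemma edge_incident A y : A \in edges e -> y \in A ->
  exists2 z, e y z & A = [set y; z].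
Proof.
case/edgesP => x [z [xz ->]]; rewrite !inE => /orP[]/eqP->; first by exists z.
by exists x; rewrite 1?e_sym // setUC.
Qed.

Lemma card_edge A : A \in edges e -> #|A| = 2.
Proof. by case/edgesP => x [y [/edge_neq xy ->]]; rewrite cards2 xy. Qed.

Lemma card_triangle t : t \in triangles e -> #|t| = 3.
Proof. by rewrite inE => /andP[/eqP]. Qed.

Lemma triangle_adj t x y :
  t \in triangles e -> x \in t -> y \in t -> x != y -> e x y.
Proof.
rewrite inE => /andP[_ /forall_inP te] xt yt.
by move/forall_inP/(_ y yt)/implyP: (te x xt).
Qed.

Lemma triangle_set3 x y z : e x y -> e y z -> e x z ->
  [set x; y; z] \in triangles e.
Proof.
move=> xy yz xz; have [yx zy zx] : [/\ e y x, e z y & e z x].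
  by split; rewrite e_sym.
rewrite inE -setUA cardsU1 cards2 !inE negb_or !edge_neq //=.
apply/forall_inP => a; rewrite !inE => ha; apply/forall_inP => b; rewrite !inE.
by case/or3P: ha => /eqP->; case/or3P=> /eqP->; rewrite ?eqxx //; apply/implyP.
Qed.

Lemma triangle_eq3 t x y z : t \in triangles e -> uniq [:: x; y; z] ->
  x \in t -> y \in t -> z \in t -> t = [set x; y; z].
Proof.
move=> tT; rewrite /= !inE negb_or andbT => /andP[/andP[xy xz] yz] xt yt zt.
apply/esym/eqP; rewrite eqEcard (card_triangle tT) -setUA cardsU1 cards2.
by rewrite !inE negb_or xy xz yz !subUset !sub1set xt yt zt.
Qed.

(** A triangle on the edge is determined by its third vertex, which is a common neighbour of the
    ends. *)
Lemma triangle_countE x y : e x y ->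
  triangle_count e [set x; y] = #|[set z | e x z && e y z]|.
Proof.
move=> xy; rewrite /triangle_count.
have -> : [set t in triangles e | [set x; y] \subset t] =
    [set [set x; y; z] | z in [set z | e x z && e y z]].
  apply/setP => t; rewrite inE; apply/andP/imsetP => [[tT]|[z]].
    rewrite subUset !sub1set => /andP[xt yt].
    have /set0Pn[z] : t :\: [set x; y] != set0.
      rewrite -card_gt0 cardsD (setIidPr _) ?subUset ?sub1set ?xt //.
      by rewrite (card_triangle tT) cards2 edge_neq.
    rewrite !inE negb_or => /andP[/andP[zx zy] zt].
    exists z; first by rewrite inE !(triangle_adj tT) // eq_sym.
    apply: triangle_eq3 => //.
    by rewrite /= !inE negb_or andbT edge_neq //= ![_ == z]eq_sym zx.
  rewrite inE => /andP[xz yz] ->; split; last exact: subsetUl.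
  exact: triangle_set3.
rewrite card_in_imset // => z w; rewrite !inE => /andP[xz yz] /andP[xw yw].
move/setP/(_ z); rewrite !inE eqxx orbT => /esym/orP[/orP[]|] /eqP // zE.
  by rewrite zE e_irr in xz.
by rewrite zE e_irr in yz.
Qed.

(** By the last hypothesis the edge [xy] lies in deg x - 1 triangles, the most that any edge at [x]
    can have. *)
Lemma leq_triangle_count x y z : e x y -> e x z ->
    (forall w, e x w -> w != y -> e y w) ->
  (triangle_count e [set x; z] <= triangle_count e [set x; y])%N.
Proof.
move=> xy xz xyw; rewrite !triangle_countE //.
set N := [set w | e x w].
have NxE w : e x w -> #|N :\ w| = #|N|.-1.
  by move=> xw; rewrite [in RHS](cardsD1 w) inE xw.
apply: (@leq_trans #|N :\ z|).
  apply/subset_leq_card/subsetP => w; rewrite !inE => /andP[-> zw].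
  by rewrite eq_sym edge_neq.
rewrite (NxE z xz) -(NxE y xy); apply/subset_leq_card/subsetP => w.
by rewrite !inE => /andP[wy xw]; rewrite xw xyw.
Qed.

Lemma graph_iso_completeP :
  graph_iso e (@complete_graph #|V|) <-> forall x y, e x y = (x != y).
Proof.
split=> [[h /bij_inj h_inj hE] x y|eE].
  by rewrite -hE /complete_graph inj_eq.
exists enum_rank; first exact: enum_rank_bij.
by move=> x y; rewrite eE /complete_graph (inj_eq enum_rank_inj).
Qed.

(** Along a path from [x], adjacency to [x] passes from each vertex to the next one, unless that is
    [x] itself. *)
Lemma connected_trans_complete : (forall x y, connect e x y) ->
    (forall x y z, x != z -> e x y -> e y z -> e x z) ->
  forall x y, e x y = (x != y).
Proof.
move=> e_conn e_trans x y; apply/idP/idP => [/edge_neq //|].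
have /connectP[p] := e_conn x y; elim/last_ind: p y => [|p w IH] y /=.
  by move=> _ ->; rewrite eqxx.
rewrite rcons_path last_rcons => /andP[xp pw] -> xw.
move: pw; have [<- //|xl] := eqVneq x (last x p) => pw.
by apply: e_trans pw => //; apply: IH.
Qed.

(** * Signed incidences of edges with vertices and triangles *)

Variables (R : numDomainType) (tl hd : {set V} -> V) (cyc : {set V} -> seq V).
Hypotheses (tl_hdP : edge_orientation e tl hd).
Hypotheses (cycP : triangle_orientation e cyc).

(** [bsign] and [csign] are the entries of the two incidence matrices, indexed by the vertices,
    edges and triangles themselves instead of ordinals. *)
Definition bsign A v : R :=
  if v == tl A then -1 else if v == hd A then 1 else 0.

Definition csign t A : R :=
  if A \subset t then if next (cyc t) (tl A) == hd A then 1 else -1 else 0.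

Lemma edge_ends x y : e x y ->
  (tl [set x; y] = x /\ hd [set x; y] = y) \/
  (tl [set x; y] = y /\ hd [set x; y] = x).
Proof.
move=> xy; have := tl_hdP (mem_edges xy).
move: (tl _) (hd _) => a b /setP AE.
have := AE x; have := AE y; have := AE a; have := AE b.
have /negPf xyF := edge_neq xy; have yxF : y == x = false by rewrite eq_sym.
rewrite !inE !eqxx ?orbT /= => bxy axy yab xab.
case/orP: axy yab xab => /eqP->; rewrite ?xyF ?yxF /= => yb xb; [left|right].
  by split=> //; apply/esym/eqP; rewrite -yb.
by split=> //; apply/esym/eqP; rewrite -xb.
Qed.

Lemma tl_neq_hd A : A \in edges e -> tl A != hd A.
Proof.
case/edgesP => x [y [xy ->]]; have := edge_neq xy.
by case: (edge_ends xy) => -[-> ->] //; rewrite eq_sym.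
Qed.

Lemma bsign_out A v : A \in edges e -> v \notin A -> bsign A v = 0.
Proof.
move=> /tl_hdP AE; rewrite {1}AE !inE negb_or /bsign.
by move=> /andP[/negPf-> /negPf->].
Qed.

(** The incidence matrix acts on functions of the vertices as a discrete gradient. *)
Lemma sum_bsign A (f : V -> R) : A \in edges e ->
  \sum_v bsign A v * f v = f (hd A) - f (tl A).
Proof.
move=> AE; have ht := tl_neq_hd AE.
rewrite (bigD1 (tl A)) //= (bigD1 (hd A)) /=; last by rewrite eq_sym.
rewrite big1 => [|v /andP[vt vh]]; last first.
  by rewrite /bsign (negPf vt) (negPf vh) mul0r.
by rewrite /bsign eqxx eq_sym (negPf ht) eqxx; ring.
Qed.

Lemma sum_bsign_sqr A : A \in edges e -> \sum_v bsign A v * bsign A v = 2.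
Proof.
move=> AE; rewrite sum_bsign // /bsign eqxx eq_sym (negPf (tl_neq_hd AE)) eqxx.
by ring.
Qed.

Lemma bsign_sqr x y : e x y -> bsign [set x; y] y ^+ 2 = 1.
Proof.
move=> xy; have yx : y == x = false by rewrite eq_sym; apply/negbTE/edge_neq.
by case: (edge_ends xy) => -[tA hA]; rewrite /bsign tA hA ?yx eqxx; ring.
Qed.

(** Since [x] and [z] differ, [y] is the only vertex on both edges. *)
Lemma sum_bsign_adj x y z : e x y -> e y z -> x != z ->
  \sum_v bsign [set x; y] v * bsign [set y; z] v =
  bsign [set x; y] y * bsign [set y; z] y.
Proof.
move=> xy yz xz; have xyN := edge_neq xy; have yx : y == x = false.
  by rewrite eq_sym; apply/negbTE.
have x0 : bsign [set y; z] x = 0.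
  by rewrite bsign_out ?mem_edges // !inE negb_or xyN.
rewrite sum_bsign ?mem_edges //; move: (bsign [set y; z]) x0 => f x0.
rewrite /bsign.
by case: (edge_ends xy) => -[-> ->]; rewrite ?yx eqxx x0; ring.
Qed.

(** The walk x, y, z follows the cyclic orientation on both edges or on neither, so the product on
    the left is that of the orientation signs along the walk. At [y] these are [bsign] for the edge
    walked in and its negative for the edge walked out. *)
Lemma csign_adj x y z : e x y -> e y z -> e x z ->
  csign [set x; y; z] [set x; y] * csign [set x; y; z] [set y; z] =
  - (bsign [set x; y] y * bsign [set y; z] y).
Proof.
move=> xy yz xz; have tT := triangle_set3 xy yz xz.
have [xyN yzN xzN] : [/\ x != y, y != z & x != z] by rewrite !edge_neq.
have yx : y == x = false by rewrite eq_sym; apply/negbTE.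
have pc := cycP tT.
have mem_cyc v : (v \in cyc [set x; y; z]) = (v \in [set x; y; z]).
  by rewrite (perm_mem pc) mem_enum.
have [] := @next_cycle3 _ (cyc [set x; y; z]) x y z.
- by rewrite (perm_uniq pc) enum_uniq.
- by rewrite (perm_size pc) -cardE (card_triangle tT).
- by rewrite mem_cyc !inE eqxx.
- by rewrite mem_cyc !inE eqxx orbT.
- by rewrite mem_cyc !inE eqxx orbT.
- by rewrite /= !inE negb_or xyN xzN yzN.
move=> n1 n2 n3; rewrite /csign subsetUl.
have -> : [set y; z] \subset [set x; y; z] by rewrite -setUA subsetUr.
rewrite /bsign.
(* Four orientations of the two edges, times two cyclic orientations. *)
case: (edge_ends xy) => -[-> ->]; case: (edge_ends yz) => -[-> ->];
  rewrite ?n1 ?n2 ?n3 ?yx ?(negPf yzN) ?eqxx; case: (next _ x == y) => /=; ring.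
Qed.

Lemma sum_csign_sqr A :
  \sum_(t in triangles e) csign t A * csign t A = (triangle_count e A)%:R.
Proof.
rewrite /triangle_count -sum1_card natr_sum big_mkcond [RHS]big_mkcond /=.
apply: eq_bigr => t _; rewrite !inE -/(triangles e) /csign.
case: (_ && _) => //=; case: (A \subset t) => //=; last by rewrite mulr0.
by case: ifP => _; ring.
Qed.

(** A triangle containing both edges can only be [xyz], which exists exactly when [xz] is an
    edge. *)
Lemma sum_csign_adj x y z : e x y -> e y z -> x != z ->
  \sum_(t in triangles e) csign t [set x; y] * csign t [set y; z] =
  if e x z then - (bsign [set x; y] y * bsign [set y; z] y) else 0.
Proof.
move=> xy yz xzN.
have tE t : t \in triangles e -> csign t [set x; y] * csign t [set y; z] != 0 ->
    e x z /\ t = [set x; y; z].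
  move=> tT; rewrite /csign !subUset !sub1set.
  case xt: (x \in t) => /=; last by rewrite mul0r eqxx.
  case yt: (y \in t) => /=; last by rewrite mul0r eqxx.
  case zt: (z \in t) => /=; last by rewrite mulr0 eqxx.
  move=> _; split; first exact: (triangle_adj tT).
  by apply: triangle_eq3 => //; rewrite /= !inE negb_or xzN !edge_neq.
case: ifP => xz; last first.
  rewrite big1 // => t tT; apply/eqP; by apply: contraFT xz => /(tE _ tT)[].
rewrite (bigD1 [set x; y; z]) ?triangle_set3 //= csign_adj //.
rewrite big1 ?addr0 // => t /andP[tT tN]; apply/eqP.
by apply: contraNT tN => /(tE _ tT)[_ /eqP].
Qed.

Lemma sum_bsign_disj A A' : A \in edges e -> A' \in edges e ->
  [disjoint A & A'] -> \sum_v bsign A v * bsign A' v = 0.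
Proof.
move=> AE AE' dis; rewrite big1 // => v _.
have [vA|vA] := boolP (v \in A); last by rewrite bsign_out ?mul0r.
by rewrite [bsign A' v]bsign_out ?mulr0 // (disjointFr dis).
Qed.

(** A triangle containing both edges would have four vertices. *)
Lemma sum_csign_disj A A' : A \in edges e -> A' \in edges e ->
  [disjoint A & A'] -> \sum_(t in triangles e) csign t A * csign t A' = 0.
Proof.
move=> AE AE' dis; rewrite big1 // => t tT; rewrite /csign.
case At: (A \subset t); last by rewrite mul0r.
case At': (A' \subset t); last by rewrite mulr0.
have : (#|A :|: A'| <= #|t|)%N by rewrite subset_leq_card // subUset At.
rewrite cardsU disjoint_setI0 // cards0 (card_triangle tT).
by rewrite (card_edge AE) (card_edge AE').
Qed.

(** * Entries of the Helmholtzian *)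

Local Notation H := (helmholtzian R e tl hd cyc).

Lemma helmholtzianE i j : H i j =
  \sum_v bsign (enum_val i) v * bsign (enum_val j) v +
  \sum_(t in triangles e) csign t (enum_val i) * csign t (enum_val j).
Proof.
rewrite !mxE; congr (_ + _).
  rewrite [RHS](eq_bigl (mem V)) // [RHS]big_enum_val /=.
  by apply: eq_bigr => k _; rewrite !mxE.
by rewrite [RHS]big_enum_val; apply: eq_bigr => k _; rewrite !mxE.
Qed.

Lemma trmx_helmholtzian : H^T = H.
Proof. by rewrite /helmholtzian linearD /= !trmx_mul !trmxK. Qed.

Lemma helmholtzian_diag i :
  H i i = (triangle_count e (enum_val i))%:R + 2.
Proof.
by rewrite helmholtzianE sum_csign_sqr sum_bsign_sqr ?enum_valP // addrC.
Qed.

Lemma helmholtzian_adj i j x y z : enum_val i = [set x; y] ->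
    enum_val j = [set y; z] -> e x y -> e y z -> x != z ->
  H i j = if e x z then 0 else bsign [set x; y] y * bsign [set y; z] y.
Proof.
move=> iE jE xy yz xz; rewrite helmholtzianE iE jE sum_bsign_adj //.
by rewrite sum_csign_adj //; case: ifP => _; rewrite ?subrr ?addr0.
Qed.

(** All n - 2 vertices off an edge are common neighbours of its ends, so the diagonal entries are n.
    Disjoint edges have entry 0, and so do adjacent ones because the third side is present. *)
Lemma helmholtzian_complete : (forall x y, e x y = (x != y)) -> H = #|V|%:R%:M.
Proof.
move=> eE; apply/matrixP => i j; rewrite [in RHS]mxE.
have [<-|ij] := eqVneq i j.
  have /edgesP[x [y [xy iE]]] := enum_valP i.
  rewrite helmholtzian_diag iE triangle_countE //.
  have -> : [set z | e x z && e y z] = ~: [set x; y].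
    by apply/setP => z; rewrite !inE negb_or !eE ![_ == z]eq_sym.
  rewrite mulr1n -natrD; congr _%:R.
  by rewrite -(cardsC [set x; y]) cards2 edge_neq // addnC.
rewrite mulr0n; have iP := enum_valP i; have jP := enum_valP j.
have [dis|] := boolP [disjoint enum_val i & enum_val j].
  by rewrite helmholtzianE sum_bsign_disj // sum_csign_disj // addr0.
rewrite -setI_eq0 => /set0Pn[y]; rewrite inE => /andP[yi yj].
have [x yx iE] := edge_incident iP yi; have [z yz jE] := edge_incident jP yj.
have xz : x != z.
  by apply: contra_neq ij => xz; apply: enum_val_inj; rewrite iE jE xz.
rewrite (helmholtzian_adj (x := x) (y := y) (z := z)) ?eE ?xz //.
- by rewrite iE setUC.
- by rewrite eq_sym -eE.
- by rewrite -eE.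
Qed.

End Graph.

(** * The quadratic form on an induced path *)

Lemma helmholtzian_induced_P3 (R : rcfType) (V : finType) (e : rel V)
    (e_sym : symmetric e) (e_irr : irreflexive e) (tl hd : {set V} -> V)
    (tl_hdP : edge_orientation e tl hd) (cyc : {set V} -> seq V)
    (cycP : triangle_orientation e cyc) (lam : R) (x y z : V) :
    (forall c, eigenvalue (helmholtzian R e tl hd cyc) c -> lam <= c) ->
    e x y -> e y z -> x != z -> ~~ e x z ->
  exists2 s : R, s ^+ 2 = 1 & forall a b : R,
    lam * (a ^+ 2 + b ^+ 2) <=
      a ^+ 2 * ((triangle_count e [set x; y])%:R + 2) + a * b * s *+ 2
      + b ^+ 2 * ((triangle_count e [set y; z])%:R + 2).
Proof.
move=> lam_le xy yz xz xzN.
have xyE := mem_edges xy; have yzE := mem_edges yz.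
pose i : 'I_#|edges e| := enum_rank_in xyE [set x; y].
pose j : 'I_#|edges e| := enum_rank_in yzE [set y; z].
have iE : enum_val i = [set x; y] by apply: enum_rankK_in.
have jE : enum_val j = [set y; z] by apply: enum_rankK_in.
have ij : i != j.
  apply: contraTneq (set21 x y) => ij; rewrite -iE ij jE !inE negb_or.
  by rewrite xz (edge_neq e_irr xy).
(* This is the off-diagonal entry, a sign depending on the orientations; recording only its square
   keeps them out of what follows. *)
exists (bsign R tl hd [set x; y] y * bsign R tl hd [set y; z] y).
  have zy : e z y by rewrite e_sym.
  rewrite exprMn (bsign_sqr e_irr R tl_hdP xy) mul1r [[set y; z]]setUC.
  exact: bsign_sqr.
move=> a b; have := rayleigh_pair a b (trmx_helmholtzian _ _ _ _ _) lam_le ij.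
rewrite !helmholtzian_diag // iE jE.
by rewrite (helmholtzian_adj e_sym e_irr R tl_hdP cycP iE jE) // (negPf xzN).
Qed.

(** * The two bounds and the case of equality *)

Theorem theorem3p10 (R : rcfType) (V : finType) (e : rel V)
  (n m : nat) (e_sym : symmetric e) (e_irr : irreflexive e)
  (e_conn : forall x y : V, connect e x y)
  (order_n : #|V| = n) (size_m : #|edges e| = m) (m_ge1 : (1 <= m)%N)
  (tl hd : {set V} -> V) (tl_hdP : edge_orientation e tl hd)
  (cyc : {set V} -> seq V) (cycP : triangle_orientation e cyc)
  (lam : R)
  (lam_least : is_least (fun x : R => eigenvalue (helmholtzian R e tl hd cyc) x)
                        lam) :
  (exists mu : R,
     [/\ is_least (fun x : R => exists2 A, A \in edges e
                                         & x = (triangle_count e A)%:R + 2) mu,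
         lam <= mu
       & lam = mu <-> graph_iso e (@complete_graph n)])
  /\
  (~ graph_iso e (@complete_graph n) ->
   exists2 nu : R,
     is_least (fun x : R => exists A1 A2, induced_P3 e A1 A2
                 /\ x = ((triangle_count e A1)%:R + (triangle_count e A2)%:R) / 2 + 1) nu
     & lam <= nu).
Proof.
subst n m; have [lam_eig lam_le] := lam_least.
set H := helmholtzian R e tl hd cyc in lam_eig lam_le *.
have lam_tc A : A \in edges e -> lam <= (triangle_count e A)%:R + 2.
  move=> AE; pose i : 'I_#|edges e| := enum_rank_in AE A.
  have := rayleigh_diag i (trmx_helmholtzian _ _ _ _ _) lam_le.
  by rewrite helmholtzian_diag // enum_rankK_in.
split=> [|not_iso]; last first.
  (* Part (ii): induced paths become triples of vertices, a finite type on which a minimum is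
     attained. If there were none, adjacency would be transitive on distinct vertices and the graph
     complete. *)
  pose P (p : V * V * V) := [&& p.1.1 != p.2, e p.1.1 p.1.2, e p.1.2 p.2
                              & ~~ e p.1.1 p.2].
  pose F (p : V * V * V) : R := ((triangle_count e [set p.1.1; p.1.2])%:R +
                                 (triangle_count e [set p.1.2; p.2])%:R) / 2 + 1.
  have [|[[x y] z] /and4P[/= xz xy yz xzN] leF] := @ex_min_fin _ _ P F.
    apply/existsP; apply: contraT => /existsPn noP; case: not_iso.
    apply/graph_iso_completeP/(connected_trans_complete e_irr e_conn).
    move=> x y z xz xy yz; have := noP (x, y, z).
    by rewrite /P /= xz xy yz negbK.
  exists (F (x, y, z)).
    split; first by exists [set x; y], [set y; z]; split=> //; exists x, y, z;
      split=> //; rewrite xy yz.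
    move=> _ [A1 [A2 [[x' [y' [z' [-> -> xz' /andP[xy' yz'] xzN']]]] ->]]].
    by apply: (leF (x', y', z')); rewrite /P /= xz' xy' yz' xzN'.
  (* These weights make the cross term -2 whatever the sign [s], while the squares sum to 2. *)
  have [s s2 /(_ 1 (- s))] :=
    helmholtzian_induced_P3 e_sym e_irr tl_hdP cycP lam_le xy yz xz xzN.
  by rewrite /F /= sqrrN s2 mul1r mulNr -expr2 s2; lra.
have [|A0 A0E leA0] := @ex_min_fin _ R (fun A => A \in edges e)
    (fun A => (triangle_count e A)%:R + 2).
  by move: m_ge1; rewrite card_gt0 => /set0Pn.
exists ((triangle_count e A0)%:R + 2); split.
- by split=> [|_ [A AE ->]]; [exists A0 | apply: leA0].
- exact: lam_tc.
split=> [lamE|/graph_iso_completeP eE]; last first.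
  (* For a complete graph both [lam] and the diagonal entry at [A0] equal n. *)
  have HE : H = #|V|%:R%:M by apply: helmholtzian_complete.
  have [v] := eigenvalueP lam_eig; rewrite HE mul_mx_scalar => vE v0.
  have -> : lam = #|V|%:R.
    have : (#|V|%:R - lam) *: v == 0 by rewrite scalerBl vE subrr.
    by rewrite scalemx_eq0 (negPf v0) orbF subr_eq0 => /eqP.
  have := helmholtzian_diag e_irr R cyc tl_hdP (enum_rank_in A0E A0).
  by rewrite -/H HE enum_rankK_in // mxE eqxx.
pose minimal A := (triangle_count e A)%:R + 2 = lam.
have minimal_adj x y z : e x y -> minimal [set x; y] -> e y z -> x != z ->
    e x z.
  move=> xy minxy yz xz; apply: contraT => xzN.
  have [s s2] :=
    helmholtzian_induced_P3 e_sym e_irr tl_hdP cycP lam_le xy yz xz xzN.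
  (* With b = 1 the terms in a^2 cancel, leaving 0 <= 2 a s + d - lam; the chosen a makes the right
     side -1. *)
  rewrite minxy; set d : R := _%:R + 2 => /(_ (- s * (d - lam + 1) / 2) 1).
  have -> : - s * (d - lam + 1) / 2 * 1 * s *+ 2 = - (d - lam + 1) * s ^+ 2.
    by field.
  by rewrite s2; lra.
have minimal_star x y z : e x y -> minimal [set x; y] -> e x z ->
    minimal [set x; z].
  move=> xy minxy xz; apply/eqP; rewrite eq_le lam_tc ?mem_edges // andbT.
  rewrite -minxy lerD2r ler_nat leq_triangle_count // => w xw wy.
  (* The path is y, x, w: its first edge is minimal, so [yw] is an edge. *)
  by apply: (minimal_adj y x w); rewrite // 1?e_sym // 1?setUC // eq_sym.
have minimal_all x y : e x y -> minimal [set x; y].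
  (* One minimal edge at each vertex suffices; this is carried along a path starting at an end of
     [A0]. *)
  suff [z xz minxz] : exists2 z, e x z & minimal [set x; z].
    exact: minimal_star xz minxz.
  have /edgesP[x0 [y0 [xy0 A0xy]]] := A0E.
  have /connectP[p] := e_conn x0 x; elim/last_ind: p x => [|p w IH] x /=.
    by move=> _ ->; exists y0; rewrite // -A0xy /minimal lamE.
  rewrite rcons_path last_rcons => /andP[xp pw] ->.
  have [z lz minlz] := IH _ xp erefl.
  (* The last edge of the path is minimal as part of the star of its first end, and it is also an
     edge at [w]. *)
  exists (last x0 p); first by rewrite e_sym.
  by rewrite setUC; exact: minimal_star lz minlz pw.
apply/graph_iso_completeP/(connected_trans_complete e_irr e_conn).
by move=> x y z xz xy yz; apply: minimal_adj (minimal_all _ _ xy) yz xz.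
Qed.
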